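(* Let $R$ be one of the following rings: (a) $R$ is a finite commutative local ring with $r=m^2$ odd, where $r=|R|$ and $m$ is the cardinality of the maximal ideal of $R$; (b) $R=\mathbb{F}_{q_1}\times\mathbb{F}_{q_2}\neq\mathbb{F}_3\times\mathbb{F}_3$ with $q_1,q_2\ge 3$, at least one of them odd; or (c) $R=\mathbb{F}_3\times\mathbb{F}_5\times\mathbb{F}_5$. Then $\{G_R,G_R^+,\bar G_R\}$ are integral equienergetic non-isospectral graphs.
   Context: Rings have identity $1\neq0$. $G_R$ is the graph with vertex set $R$ in which $v,w$ are adjacent iff $w-v\in R^*$ (the group of units of $R$); $G_R^+$ is the graph with vertex set $R$ in which $v,w$ are adjacent iff $v+w\in R^*$ (with a loop at $x$ when $x+x\in R^*$); $\bar G_R$ is the (loopless) complement of $G_R$. Eigenvalues are those of the adjacency matrix (a loop gives a diagonal entry $1$). A graph is integral if all its eigenvalues are integers. The energy is the sum of the absolute values of the eigenvalues with multiplicity. A set of graphs with the same number of vertices is equienergetic if all have the same energy, and non-isospectral if they have pairwise different spectra (eigenvalues with multiplicities). $\mathbb{F}_q$ is the field with $q$ elements. *)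

(* Defs.v *)
From HB Require Import structures.
From mathcomp Require Import all_boot all_order all_algebra all_field.

Set Implicit Arguments.
Unset Strict Implicit.
Unset Printing Implicit Defensive.

Import Order.TTheory GRing.Theory Num.Theory.
Local Open Scope ring_scope.

(* A graph on V, possibly with loops, is given by its adjacency relation. *)

Section Graphs.
Variable V : finType.
Implicit Types (e : rel V) (gs : seq (rel V)).

Definition adjacency_matrix e : 'M[algC]_#|V| :=
  \matrix_(i, j) (e (enum_val i) (enum_val j))%:R.

(* Eigenvalues with algebraic multiplicities, listed in an unspecified order;
   only meaningful up to perm_eq. *)
Definition spectrum e : seq algC :=
  sval (closed_field_poly_normal (char_poly (adjacency_matrix e))).

Definition energy e : algC := \sum_(z <- spectrum e) `|z|.

Definition integral_graph e : bool := all [in Num.int] (spectrum e).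

Definition isospectral e1 e2 : bool := perm_eq (spectrum e1) (spectrum e2).

Definition integral_graphs gs : bool := all integral_graph gs.

Definition equienergetic gs : bool :=
  pairwise (fun e1 e2 => energy e1 == energy e2) gs.

Definition non_isospectral gs : bool :=
  pairwise (fun e1 e2 => ~~ isospectral e1 e2) gs.

Definition complement_graph e : rel V := fun v w => (v != w) && ~~ e v w.

End Graphs.

Definition unitary_cayley_graph (R : finComUnitRingType) : rel R :=
  fun v w => w - v \is a GRing.unit.

Definition unitary_cayley_sum_graph (R : finComUnitRingType) : rel R :=
  fun v w => v + w \is a GRing.unit.

(* idealr_closed includes properness. *)
Definition maximal_ideal (R : finComUnitRingType) (M : {set R}) : Prop :=
  idealr_closed M /\
  forall I : {set R}, idealr_closed I -> M \subset I -> I = M.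

Definition local_ring (R : finComUnitRingType) : Prop :=
  exists! M : {set R}, maximal_ideal M.

Definition ring_iso (A B : nzRingType) : Prop :=
  exists f : {rmorphism A -> B}, bijective f.

(* Main.v *)
Require Import Defs.
From HB Require Import structures.
From mathcomp Require Import all_boot all_order all_algebra all_field.
From mathcomp Require Import spectral ring zify.

Set Implicit Arguments.
Unset Strict Implicit.
Unset Printing Implicit Defensive.

Import Order.TTheory GRing.Theory Num.Theory.
Local Open Scope ring_scope.

(** Write [r] for the order of [R] and [k] for its number of units.  The graph
    [G_R] is [k]-regular, so its spectrum is [k :: s] and the spectrum of its
    complement is [r - 1 - k :: [seq - 1 - z | z <- s]].  The square of the
    adjacency matrix of [G_R^+] equals that of [G_R], because replacing the
    middle vertex [u] of a walk [v, u, w] by [- u] turns one kind of walk into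
    the other; hence both graphs have the same eigenvalues up to sign, the
    same energy, and are integral together.  What remains
    ([unitary_cayley_criterion]) is to know [s] as a list of integers, to
    check one numerical identity saying that the complement has the energy of
    [G_R], and to tell the spectra apart.

    For the spectrum, a local ring with maximal ideal [M] has as unitary Cayley
    graph the complete multipartite graph on the cosets of [M]
    ([local_maximal_ideal], [multipartite_spectrum]), and for a product of
    rings the graph is the tensor product, whose eigenvalues are the products
    of eigenvalues ([int_spectrum_tensor]).  With [r = m ^ 2], all three
    energies are [2 m (m - 1)]; for a product of fields of orders [a + 1] and
    [b + 1] they are [4 a b]; for orders 3, 5 and 5 they are 256.

    The spectra are told apart by counting closed walks, since the [n]-th power
    sum of the spectrum is the number of closed walks of length [n]
    ([spectrum_power_sum]).  For [n = 2] this number is [r] times the degree,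
    which separates the complement from the other two graphs unless
    [r = 2 k + 1]; among the rings considered, only the excluded product of two
    fields of order 3 satisfies that equality.  For [G_R] against [G_R^+],
    when 2 is a unit take [n = 1]: [G_R] has no loop, and [G_R^+] has one at 1.
    In a product of two fields 2 may vanish in one factor; there [n = 3] works,
    as a field of order [q] in which 2 is nonzero has [(q - 1) ^ 3 - (q - 1)]
    closed walks of length 3 for the difference graph and [(q - 1) ^ 3] for the
    sum graph.

    Power sums also serve to compute the spectra, since they determine a finite
    multiset of complex numbers ([perm_eq_power_sums]): counting walks in tensor
    products, or in a graph whose kernel is shifted by a constant, suffices. *)

(** * Spectra of complex matrices *)

Definition mx_spectrum n (A : 'M[algC]_n) : seq algC :=
  sval (closed_field_poly_normal (char_poly A)).

Lemma mx_spectrumE n (A : 'M[algC]_n) :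
  char_poly A = \prod_(z <- mx_spectrum A) ('X - z%:P).
Proof.
rewrite /mx_spectrum; case: closed_field_poly_normal => s /= ->.
rewrite {1}(_ : lead_coef _ = 1) ?scale1r //.
exact/monicP/char_poly_monic.
Qed.

Lemma char_poly_simmx n (P A T : 'M[algC]_n) :
  P \in unitmx -> P *m A = T *m P -> char_poly A = char_poly T.
Proof.
move=> Pu PA; rewrite /char_poly.
have Pu' : \det (map_mx polyC P) != 0.
  by rewrite det_map_mx polyC_eq0 -unitfE -unitmxE.
apply: (mulfI Pu'); rewrite -det_mulmx mulrC -det_mulmx.
congr (\det _); rewrite /char_poly_mx mulmxBl mulmxBr -!map_mxM PA.
by rewrite scalar_mxC.
Qed.

Lemma mx_spectrum_trig n (P A T : 'M[algC]_n) :
    P \in unitmx -> P *m A = T *m P -> is_trig_mx T ->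
  perm_eq (mx_spectrum A) [seq T i i | i <- enum 'I_n].
Proof.
move=> Pu PA Ttrig; apply: prod_XsubC_eq.
rewrite -mx_spectrumE (char_poly_simmx Pu PA) char_poly_trig //.
by rewrite big_map big_enum.
Qed.

Lemma mx_triangularize n (A : 'M[algC]_n) :
  exists P T : 'M[algC]_n, [/\ P \in unitmx, P *m A = T *m P & is_trig_mx T].
Proof.
case: n A => [|n] A.
  exists 1%:M, A; split; rewrite ?unitmx1 ?mul1mx ?mulmx1 //.
  by apply/is_trig_mxP; case.
have [//|P /unitarymx_unit Pu PA] := @Schur algC n.+1 A.
exists P, (P *m A *m invmx P); rewrite mulmxKV //; split=> //.
by move: PA; rewrite /similar_to -conjumx.
Qed.

Lemma trig_expr n (T : 'M[algC]_n) k : is_trig_mx T ->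
  is_trig_mx (T ^+ k) /\ forall i, (T ^+ k) i i = T i i ^+ k.
Proof.
move=> /is_trig_mxP Tt; elim: k => [|k [/is_trig_mxP IHt IHd]].
  split=> [|i]; last by rewrite !expr0 mxE eqxx.
  by apply/is_trig_mxP => i j ij; rewrite expr0 mxE -val_eqE ltn_eqF.
split=> [|i].
  apply/is_trig_mxP => i j ij; rewrite exprS mxE big1 // => u _.
  have [ui|iu] := leqP u i; last by rewrite Tt ?mul0r.
  by rewrite IHt ?mulr0 // (leq_ltn_trans ui).
rewrite !exprS mxE (bigD1 i) //= IHd big1 ?addr0 // => u.
rewrite neq_ltn => /orP [ui|iu]; last by rewrite Tt ?mul0r.
by rewrite IHt ?mulr0.
Qed.

(** Powers of a triangular matrix have the powers of its diagonal on their
    diagonal, so triangularizing [A] gives multiplicities as well. *)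
Lemma mx_spectrum_expr n (A : 'M[algC]_n) k :
  perm_eq (mx_spectrum (A ^+ k)) [seq z ^+ k | z <- mx_spectrum A].
Proof.
have [P [T [Pu PA Tt]]] := mx_triangularize A.
have PAk : P *m A ^+ k = T ^+ k *m P.
  elim: k => [|k IH]; first by rewrite !expr0 mulmx1 mul1mx.
  by rewrite !exprS -mulmxE mulmxA PA -mulmxA IH mulmxA.
have [Tkt Tkd] := trig_expr k Tt.
rewrite (permPl (mx_spectrum_trig Pu PAk Tkt)).
rewrite perm_sym (permPl (perm_map _ (mx_spectrum_trig Pu PA Tt))).
rewrite -map_comp.
by rewrite (eq_map (g := fun i => (T ^+ k) i i)) // => i; rewrite Tkd.
Qed.

Lemma mx_spectrum_opp_shift n (A : 'M[algC]_n) (a : algC) :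
  perm_eq (mx_spectrum (a%:M - A)) [seq a - z | z <- mx_spectrum A].
Proof.
have [P [T [Pu PA Tt]]] := mx_triangularize A.
have PA' : P *m (a%:M - A) = (a%:M - T) *m P.
  by rewrite mulmxBl mulmxBr PA scalar_mxC.
have Tt' : is_trig_mx (a%:M - T).
  apply/is_trig_mxP => i j ij; rewrite !mxE (is_trig_mxP Tt) //.
  by rewrite -val_eqE ltn_eqF // subr0.
rewrite (permPl (mx_spectrum_trig Pu PA' Tt')).
rewrite perm_sym (permPl (perm_map _ (mx_spectrum_trig Pu PA Tt))).
rewrite -map_comp (eq_map (g := fun i => (a%:M - T) i i)) // => i.
by rewrite !mxE eqxx.
Qed.

Lemma mxtrace_spectrum n (A : 'M[algC]_n) :
  \tr A = \sum_(z <- mx_spectrum A) z.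
Proof.
have [P [T [Pu PA Tt]]] := mx_triangularize A.
rewrite (perm_big _ (mx_spectrum_trig Pu PA Tt)) big_map big_enum /=.
by rewrite -[A](mulKmx Pu) PA mulmxA mxtrace_mulC mulmxA mulmxV // mul1mx.
Qed.

(** A polynomial in the power sums isolates the multiplicity of a number [x]:
    evaluate on both lists the polynomial vanishing at every other entry. *)
Lemma perm_eq_power_sums (s t : seq algC) :
    (forall n, \sum_(z <- s) z ^+ n = \sum_(z <- t) z ^+ n) -> perm_eq s t.
Proof.
move=> st.
have stp (p : {poly algC}) : \sum_(z <- s) p.[z] = \sum_(z <- t) p.[z].
  under eq_bigr do rewrite horner_coef.
  under [RHS]eq_bigr do rewrite horner_coef.
  rewrite exchange_big [RHS]exchange_big /=; apply: eq_bigr => i _.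
  by rewrite -!mulr_sumr st.
apply/allP => x _ /=; apply/eqP.
(* [p] vanishes on every entry of [s ++ t] other than [x]. *)
pose u := [seq z <- undup (s ++ t) | z != x].
pose p := \prod_(z <- u) ('X - z%:P).
have px : p.[x] != 0.
  rewrite -rootE root_prod_XsubC mem_filter eqxx //.
have sump (r : seq algC) : {subset r <= s ++ t} ->
    \sum_(z <- r) p.[z] = (count_mem x r)%:R * p.[x].
  move=> rst; rewrite (bigID (pred1 x)) /= [X in _ + X]big1_seq ?addr0.
    rewrite -sum1_count natr_sum mulr_suml; apply: eq_bigr => z /eqP->.
    by rewrite mul1r.
  move=> z /andP [zx /rst zr]; apply/rootP.
  by rewrite root_prod_XsubC mem_filter zx mem_undup.
have := stp p; rewrite !sump; first last.
- by move=> z zs; rewrite mem_cat zs.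
- by move=> z zt; rewrite mem_cat zt orbT.
by move=> /(mulIf px) /eqP; rewrite eqr_nat => /eqP.
Qed.

(** A kernel [K : V -> V -> algC] is a square matrix indexed by the vertices
    themselves.  Working with kernels keeps the enumeration of [V] by ordinals
    out of the graph-theoretic arguments, and [kernel_pow K n v w] is then the
    weighted number of walks of length [n] from [v] to [w]. *)
Section Kernels.
Variable V : finType.
Implicit Types K L : V -> V -> algC.

Definition kernel_mx K : 'M[algC]_#|V| :=
  \matrix_(i, j) K (enum_val i) (enum_val j).

Definition kernel_spectrum K : seq algC := mx_spectrum (kernel_mx K).

Fixpoint kernel_pow K n v w : algC :=
  if n is n'.+1 then \sum_u K v u * kernel_pow K n' u w else (v == w)%:R.

Lemma sum_enum_val (F : V -> algC) :
  \sum_v F v = \sum_(i < #|V|) F (enum_val i).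
Proof. by rewrite (reindex _ (onW_bij _ (@enum_val_bij V))). Qed.

Lemma kernel_pow1 K v w :
  kernel_pow K 1 v w = K v w.
Proof.
rewrite /= (bigD1 w) //= eqxx mulr1 big1 ?addr0 // => u /negPf ->.
by rewrite mulr0.
Qed.

Lemma kernel_powS K n v w :
  kernel_pow K n.+1 v w = \sum_u K v u * kernel_pow K n u w.
Proof. by []. Qed.

Lemma kernel_mx_pow K n : kernel_mx K ^+ n = kernel_mx (kernel_pow K n).
Proof.
apply/matrixP; elim: n => [|n IH] i j.
  by rewrite expr0 !mxE /= (inj_eq enum_val_inj).
rewrite exprS !mxE /= sum_enum_val.
by apply: eq_bigr => u _; rewrite IH !mxE.
Qed.

Definition closed_walks K n : algC := \sum_v kernel_pow K n v v.

Lemma spectrum_power_sum K n :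
  \sum_(z <- kernel_spectrum K) z ^+ n = closed_walks K n.
Proof.
rewrite -(big_map (fun z => z ^+ n) predT id).
rewrite -(perm_big _ (mx_spectrum_expr (kernel_mx K) n)) -mxtrace_spectrum.
rewrite kernel_mx_pow /mxtrace /closed_walks.
by rewrite sum_enum_val; apply: eq_bigr => i _; rewrite mxE.
Qed.

End Kernels.

(** * Spectra under operations on weighted graphs *)

Lemma kernel_spectrum_ext (V : finType) (K L : V -> V -> algC) :
  (forall v w, K v w = L v w) -> kernel_spectrum K = kernel_spectrum L.
Proof.
by move=> KL; congr mx_spectrum; apply/matrixP => i j; rewrite !mxE.
Qed.

Lemma perm_kernel_spectrum (V : finType) (K : V -> V -> algC) (s : seq algC) :
    (forall n, closed_walks K n = \sum_(z <- s) z ^+ n) ->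
  perm_eq (kernel_spectrum K) s.
Proof.
by move=> Ks; apply: perm_eq_power_sums => n; rewrite spectrum_power_sum.
Qed.

Lemma kernel_spectrum_iso (V W : finType) (f : V -> W) (K : V -> V -> algC)
    (L : W -> W -> algC) :
    bijective f -> (forall v w, K v w = L (f v) (f w)) ->
  perm_eq (kernel_spectrum K) (kernel_spectrum L).
Proof.
move=> f_bij KL; apply: perm_kernel_spectrum => n.
have powE k v w : kernel_pow K k v w = kernel_pow L k (f v) (f w).
  elim: k v w => [|k IH] v w /=; first by rewrite (bij_eq f_bij).
  rewrite [RHS](reindex f) /=; last exact: onW_bij.
  by apply: eq_bigr => u _; rewrite KL IH.
rewrite spectrum_power_sum [RHS](reindex f) /=; last exact: onW_bij.
by apply: eq_bigr => v _; rewrite powE.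
Qed.

Lemma kernel_pow_tensor (V W : finType) (K : V -> V -> algC)
    (L : W -> W -> algC) n (p q : V * W) :
  kernel_pow (fun p q => K p.1 q.1 * L p.2 q.2) n p q =
  kernel_pow K n p.1 q.1 * kernel_pow L n p.2 q.2.
Proof.
elim: n p q => [|n IH] p q /=.
  by rewrite -natrM mulnb -xpair_eqE -!surjective_pairing.
rewrite mulr_suml; under [RHS]eq_bigr do rewrite mulr_sumr.
rewrite pair_big /=; apply: eq_bigr => u _; rewrite IH; ring.
Qed.

Lemma closed_walks_tensor (V W : finType) (K : V -> V -> algC)
    (L : W -> W -> algC) n :
  closed_walks (fun p q : V * W => K p.1 q.1 * L p.2 q.2) n =
  closed_walks K n * closed_walks L n.
Proof.
rewrite /closed_walks mulr_suml; under [RHS]eq_bigr do rewrite mulr_sumr.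
by rewrite pair_big /=; apply: eq_bigr => u _; rewrite kernel_pow_tensor.
Qed.

Lemma kernel_spectrum_tensor (V W : finType) (K : V -> V -> algC)
    (L : W -> W -> algC) :
  perm_eq (kernel_spectrum (fun p q : V * W => K p.1 q.1 * L p.2 q.2))
          [seq x * y | x <- kernel_spectrum K, y <- kernel_spectrum L].
Proof.
apply: perm_kernel_spectrum => n.
rewrite closed_walks_tensor -!spectrum_power_sum big_allpairs_dep mulr_suml.
apply: eq_bigr => x _; rewrite mulr_sumr.
by apply: eq_bigr => y _; rewrite exprMn.
Qed.

Lemma kernel_spectrum_opp_shift (V : finType) (K : V -> V -> algC) a :
  perm_eq (kernel_spectrum (fun v w => a *+ (v == w) - K v w))
          [seq a - z | z <- kernel_spectrum K].
Proof.
rewrite /kernel_spectrum (_ : kernel_mx _ = a%:M - kernel_mx K).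
  exact: mx_spectrum_opp_shift.
by apply/matrixP => i j; rewrite !mxE (inj_eq enum_val_inj).
Qed.

Lemma kernel_spectrum_sqr (V : finType) (K : V -> V -> algC) :
  perm_eq (kernel_spectrum (kernel_pow K 2))
          [seq z ^+ 2 | z <- kernel_spectrum K].
Proof. by rewrite /kernel_spectrum -kernel_mx_pow mx_spectrum_expr. Qed.

(** Adding the constant [c] to a kernel whose rows and columns all sum to [k]
    only moves the eigenvalue of the constant vector, from [k] to
    [k + c * #|V|].  This covers complements, complete multipartite graphs and
    the sum graph of a field alike. *)
Section AddConstant.
Variables (V : finType) (K : V -> V -> algC) (k c : algC).
Hypothesis row_sum : forall v, \sum_w K v w = k.
Hypothesis col_sum : forall w, \sum_v K v w = k.

Lemma kernel_pow_col_sum n w : \sum_v kernel_pow K n v w = k ^+ n.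
Proof.
elim: n => [|n IH] /=.
  rewrite (bigD1 w) //= eqxx big1 ?addr0 // => v /negPf vw.
  by rewrite vw.
rewrite exchange_big exprS -IH mulr_sumr /=; apply: eq_bigr => u _.
by rewrite -mulr_suml col_sum.
Qed.

(** The correction is the same for all pairs of vertices because powers of [K]
    again have constant column sums. *)
Lemma kernel_pow_addc n v w :
  kernel_pow (fun v w => K v w + c) n v w =
  kernel_pow K n v w + ((k + c * #|V|%:R) ^+ n - k ^+ n) / #|V|%:R.
Proof.
have V0 : #|V|%:R != 0 :> algC.
  by rewrite pnatr_eq0 -lt0n; apply/card_gt0P; exists v.
elim: n v => [|n IH] v /=; first by rewrite !expr0 subrr mul0r addr0.
set d := (_ / _) in IH.
under eq_bigr do rewrite IH mulrDl !mulrDr.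
rewrite !big_split /= -mulr_suml row_sum -mulr_sumr kernel_pow_col_sum.
rewrite sumr_const -[(c * d) *+ _]mulr_natr -addrA; congr (_ + _).
by rewrite /d !exprS; field.
Qed.

Lemma closed_walks_addc n :
  closed_walks (fun v w => K v w + c) n =
  closed_walks K n + ((k + c * #|V|%:R) ^+ n - k ^+ n).
Proof.
rewrite /closed_walks; under eq_bigr do rewrite kernel_pow_addc.
rewrite big_split /= sumr_const -[(_ / _) *+ _]mulr_natr; congr (_ + _).
have [->|V0] := eqVneq #|V| 0%N; first by rewrite !mulr0 addr0 subrr.
by rewrite divfK // pnatr_eq0.
Qed.

Lemma kernel_spectrum_addc :
  perm_eq (k :: kernel_spectrum (fun v w => K v w + c))
          (k + c * #|V|%:R :: kernel_spectrum K).
Proof.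
apply: perm_eq_power_sums => n; rewrite !big_cons !spectrum_power_sum.
by rewrite closed_walks_addc; ring.
Qed.

End AddConstant.

Definition adjacency (V : finType) (e : rel V) v w : algC := (e v w)%:R.

Lemma spectrumE (V : finType) (e : rel V) :
  spectrum e = kernel_spectrum (adjacency e).
Proof. by []. Qed.

Definition regular_graph (V : finType) (e : rel V) k :=
  symmetric e /\ forall v, #|e v| = k.

Lemma regular_row_sum (V : finType) (e : rel V) k : regular_graph e k ->
  forall v, \sum_w adjacency e v w = k%:R.
Proof.
move=> [_ ek] v; rewrite -(ek v) -sum1_card natr_sum [RHS]big_mkcond /=.
by apply: eq_bigr => w _; rewrite /adjacency unfold_in; case: (e v w).
Qed.

Lemma regular_col_sum (V : finType) (e : rel V) k : regular_graph e k ->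
  forall w, \sum_v adjacency e v w = k%:R.
Proof.
move=> ek w; rewrite -(regular_row_sum ek w); apply: eq_bigr => v _.
by rewrite /adjacency ek.1.
Qed.

Lemma closed_walks1 (V : finType) (e : rel V) :
  closed_walks (adjacency e) 1 = #|[pred v | e v v]|%:R.
Proof.
rewrite -sum1_card natr_sum [RHS]big_mkcond; apply: eq_bigr => v _.
by rewrite kernel_pow1 /adjacency inE; case: (e v v).
Qed.

Lemma regular_closed_walks2 (V : finType) (e : rel V) k : regular_graph e k ->
  closed_walks (adjacency e) 2 = (#|V| * k)%:R.
Proof.
move=> ek; rewrite /closed_walks -sum1_card mulnC natrM natr_sum mulr_sumr.
apply: eq_bigr => v _; rewrite mulr1 -(regular_row_sum ek v) /=.
apply: eq_bigr => w _; rewrite (bigD1 v) //= eqxx mulr1 big1 ?addr0.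
  by rewrite /adjacency [e w v]ek.1; case: (e v w); rewrite ?mulr1 ?mulr0.
by move=> u /negPf uv; rewrite uv mulr0.
Qed.

Definition tensor_graph (V W : finType) (e : rel V) (f : rel W) : rel (V * W) :=
  fun p q => e p.1 q.1 && f p.2 q.2.

Lemma adjacency_tensor (V W : finType) (e : rel V) (f : rel W) p q :
  adjacency (tensor_graph e f) p q = adjacency e p.1 q.1 * adjacency f p.2 q.2.
Proof. by rewrite /adjacency -natrM mulnb. Qed.

Lemma spectrum_tensor (V W : finType) (e : rel V) (f : rel W) :
  perm_eq (spectrum (tensor_graph e f))
          [seq x * y | x <- spectrum e, y <- spectrum f].
Proof.
rewrite spectrumE (kernel_spectrum_ext (adjacency_tensor e f)).
exact: kernel_spectrum_tensor.
Qed.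

Lemma regular_tensor (V W : finType) (e : rel V) (f : rel W) k l :
  regular_graph e k -> regular_graph f l ->
  regular_graph (tensor_graph e f) (k * l).
Proof.
move=> [es ek] [fs fl]; split=> [p q|p]; first by rewrite /tensor_graph es fs.
by rewrite -(ek p.1) -(fl p.2) -cardX; apply: eq_card => q; rewrite !unfold_in.
Qed.

(** Integer lists make integrality immediate and reduce energies to sums of
    integers. *)
Definition int_spectrum (V : finType) (e : rel V) (s : seq int) :=
  perm_eq (spectrum e) [seq z%:~R | z <- s].

Lemma int_spectrum_tensor (V W : finType) (e : rel V) (f : rel W) s t :
  int_spectrum e s -> int_spectrum f t ->
  int_spectrum (tensor_graph e f) [seq x * y | x <- s, y <- t].
Proof.
move=> es ft; rewrite /int_spectrum (permPl (spectrum_tensor e f)).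
rewrite (permPl (perm_allpairs _ es ft)) map_allpairs.
rewrite allpairs_mapl allpairs_mapr.
rewrite (eq_allpairs (f2 := fun x y : int => (x * y)%:~R)) // => x y.
by rewrite intrM.
Qed.

Lemma int_spectrum_iso (V W : finType) (f : V -> W) (e : rel V) (e' : rel W) s :
    bijective f -> (forall v w, e v w = e' (f v) (f w)) ->
  int_spectrum e' s -> int_spectrum e s.
Proof.
move=> f_bij ee' e's; apply: perm_trans e's.
rewrite !spectrumE (kernel_spectrum_iso f_bij) // => v w.
by rewrite /adjacency ee'.
Qed.

Lemma regular_iso (V W : finType) (f : V -> W) (e : rel V) (e' : rel W) k :
    bijective f -> (forall v w, e v w = e' (f v) (f w)) ->
  regular_graph e' k -> regular_graph e k.
Proof.
move=> f_bij ee' [e's e'k]; split=> [v w|v]; first by rewrite !ee' e's.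
rewrite -(e'k (f v)) -!sum1_card [RHS](reindex f) /=; last exact: onW_bij.
by apply: eq_bigl => w; rewrite !unfold_in ee'.
Qed.

Lemma regular_complement (V : finType) (e : rel V) k : irreflexive e ->
  regular_graph e k -> regular_graph (complement_graph e) (#|V| - k.+1).
Proof.
move=> eirr [es ek]; split=> [v w|v].
  by rewrite /complement_graph es eq_sym.
have /eq_card -> : complement_graph e v =i [predC [predU1 v & e v]].
  by move=> w; rewrite !inE /complement_graph unfold_in negb_or eq_sym.
have := cardC [predU1 v & e v]; rewrite cardU1 ek unfold_in eirr /= => <-.
by rewrite add1n addKn.
Qed.

(** The adjacency kernel of the complement is [- I - A] plus the constant 1.
    Here [k] heads the list so that the eigenvalue of the constant vector is
    identified even when it also occurs in [s]. *)
Lemma int_spectrum_complement (V : finType) (e : rel V) k s :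
    irreflexive e -> regular_graph e k -> int_spectrum e (k%:Z :: s) ->
  int_spectrum (complement_graph e)
    (#|V|%:Z - 1 - k%:Z :: [seq - 1 - z | z <- s]).
Proof.
move=> eirr ek es.
pose K (v w : V) := (- 1) *+ (v == w) - adjacency e v w.
have Kr v : \sum_w K v w = - 1 - k%:R.
  rewrite sumrB (regular_row_sum ek) (bigD1 v) //= eqxx big1 ?addr0 //.
  by move=> w /negPf; rewrite eq_sym => ->.
have Kc w : \sum_v K v w = - 1 - k%:R.
  rewrite sumrB (regular_col_sum ek) (bigD1 w) //= eqxx big1 ?addr0 //.
  by move=> v /negPf ->.
have := kernel_spectrum_addc 1 Kr Kc.
rewrite (@kernel_spectrum_ext _ _ (adjacency (complement_graph e))); last first.
  move=> v w; rewrite /K /adjacency /complement_graph.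
  have [->|vw] := eqVneq v w; first by rewrite eirr /= subr0 addrC subrr.
  by rewrite /= sub0r; case: (e v w); rewrite ?oppr0 ?add0r // addrC subrr.
set t := [seq (- 1 - z)%:~R : algC | z <- s].
have sK : perm_eq (kernel_spectrum K) (- 1 - k%:R :: t).
  apply: perm_trans (kernel_spectrum_opp_shift _ _) _.
  rewrite -spectrumE (permPl (perm_map _ es)) -map_comp /=.
  rewrite /t (eq_map (g := fun z : int => (- 1 - z)%:~R)) // => z.
  by rewrite intrB.
(* Both sides contain [- 1 - k], the image of the eigenvalue [k] of [e]. *)
rewrite -(perm_cons (- 1 - k%:R + 1 * #|V|%:R)) in sK.
move/perm_trans => /(_ _ sK); rewrite -spectrumE => Be.
rewrite -[X in perm_eq _ X]/([:: _] ++ [:: _] ++ t) perm_sym perm_catCA in Be.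
rewrite perm_sym perm_cons in Be.
rewrite /int_spectrum /= -map_comp !intrB.
by rewrite (_ : _ - _ = - 1 - k%:R + 1 * #|V|%:R) // mul1r [RHS]addrC addrA.
Qed.

Lemma closed_walks_iso (V W : finType) (f : V -> W) (e : rel V) (e' : rel W) n :
    bijective f -> (forall v w, e v w = e' (f v) (f w)) ->
  closed_walks (adjacency e) n = closed_walks (adjacency e') n.
Proof.
move=> f_bij ee'; rewrite -!spectrum_power_sum; apply: perm_big.
by apply: kernel_spectrum_iso f_bij _ => v w; rewrite /adjacency ee'.
Qed.

Lemma closed_walks_tensor_graph (V W : finType) (e : rel V) (f : rel W) n :
  closed_walks (adjacency (tensor_graph e f)) n =
  closed_walks (adjacency e) n * closed_walks (adjacency f) n.
Proof.
rewrite -closed_walks_tensor -!spectrum_power_sum.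
by rewrite (kernel_spectrum_ext (adjacency_tensor e f)).
Qed.

(** * Graphs with integer spectrum *)

Section GraphSpectra.
Variable V : finType.
Implicit Types e E : rel V.

Lemma int_spectrum_integral e s : int_spectrum e s -> integral_graph e.
Proof.
rewrite /integral_graph => /perm_all ->; apply/allP => _ /mapP [z _ ->].
exact: intr_int.
Qed.

Lemma int_spectrum_energy e s :
  int_spectrum e s -> energy e = (\sum_(z <- s) `|z|)%:~R.
Proof.
rewrite /energy => /(perm_big _) ->; rewrite big_map /= rmorph_sum /=.
by apply: eq_bigr => z _; rewrite intr_norm.
Qed.

Lemma isospectral_closed_walks e f n : isospectral e f ->
  closed_walks (adjacency e) n = closed_walks (adjacency f) n.
Proof.
by move=> /(perm_big _) ef; rewrite -!spectrum_power_sum -!spectrumE ef.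
Qed.

Lemma regular_isospectral e f k l :
  regular_graph e k -> regular_graph f l -> isospectral e f ->
  (#|V| * k = #|V| * l)%N.
Proof.
move=> ek fl /(isospectral_closed_walks 2).
rewrite (regular_closed_walks2 ek) (regular_closed_walks2 fl).
by move/eqP; rewrite eqr_nat => /eqP.
Qed.

(** The complement of an equivalence relation [E] whose [p] classes all have
    [m] elements.  Its kernel is [1 - B] with [B] the kernel of [E], and
    [B ^ 2 = m B] makes all closed walks of [- B] explicit. *)
Section Multipartite.
Variables (E : rel V) (m p : nat).
Hypotheses (E_refl : reflexive E) (E_trans : left_transitive E).
Hypothesis E_class : forall v, #|E v| = m.
Hypothesis card_V : #|V| = (m * p)%N.
Hypothesis m_gt0 : (0 < m)%N.
Hypothesis p_gt0 : (0 < p)%N.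

Let E_sym : symmetric E.
Proof. by move=> v w; apply/idP/idP => /E_trans <-. Qed.

Lemma equivalence_regular : regular_graph E m.
Proof. by split. Qed.

Lemma multipartite_regular :
  regular_graph (fun v w => ~~ E v w) (m * p.-1).
Proof.
split=> [v w|v]; first by rewrite E_sym.
have := cardC (E v); rewrite E_class card_V => mp.
rewrite -subn1 mulnBr muln1 -mp addKn.
by apply: eq_card => w; rewrite !inE unfold_in.
Qed.

Lemma equivalence_kernel_pow n v w :
  kernel_pow (fun v w => - adjacency E v w) n.+1 v w =
  - (- m%:R) ^+ n * adjacency E v w.
Proof.
elim: n v => [|n IH] v.
  by rewrite kernel_pow1 expr0 mulN1r.
rewrite kernel_powS.
under eq_bigr do rewrite IH.
rewrite (eq_bigr (fun u =>
  (- m%:R) ^+ n * adjacency E v w * adjacency E v u)) => [|u _].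
  by rewrite -mulr_sumr (regular_row_sum equivalence_regular) exprS; ring.
rewrite /adjacency.
case Evu: (E v u); last by rewrite oppr0 mul0r mulr0.
by rewrite (E_trans Evu); ring.
Qed.

Lemma multipartite_spectrum :
  int_spectrum (fun v w => ~~ E v w)
    ((m * p.-1)%N%:Z :: nseq p.-1 (- m%:Z) ++ nseq (#|V| - p) 0).
Proof.
have r0 : (p <= #|V|)%N by rewrite card_V leq_pmull.
have sB : perm_eq (kernel_spectrum (fun v w => - adjacency E v w))
    (nseq p (- m%:R) ++ nseq (#|V| - p) 0).
  apply: perm_kernel_spectrum => n; rewrite big_cat !big_nseq /=.
  rewrite !iter_addr_0 /closed_walks; case: n => [|n].
    rewrite !expr0 -mulrnDr subnKC //.
    by under eq_bigr do rewrite /= eqxx; rewrite sumr_const.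
  under eq_bigr do rewrite equivalence_kernel_pow.
  rewrite /adjacency (eq_bigr (fun=> - (- m%:R) ^+ n)) => [|v _]; last first.
    by rewrite E_refl mulr1.
  rewrite sumr_const card_V mulrnA exprS expr0n /= mul0rn addr0.
  by rewrite mulNr mulr_natl mulNrn.
have Er v : \sum_w - adjacency E v w = - m%:R.
  by rewrite sumrN (regular_row_sum equivalence_regular).
have Ec w : \sum_v - adjacency E v w = - m%:R.
  by rewrite sumrN (regular_col_sum equivalence_regular).
have := kernel_spectrum_addc 1 Er Ec.
rewrite (kernel_spectrum_ext (L := adjacency (fun v w => ~~ E v w))); last first.
  move=> v w; rewrite /adjacency; case: (E v w) => /=; first by rewrite addNr.
  by rewrite oppr0 add0r.
rewrite -(perm_cons (- m%:R + 1 * #|V|%:R)) in sB.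
move/perm_trans => /(_ _ sB); rewrite -{1}(prednK p_gt0) /=.
rewrite -[X in perm_eq _ X]/([:: _] ++ [:: _] ++ _) perm_sym perm_catCA.
rewrite perm_sym perm_cons /int_spectrum -spectrumE /= map_cat !map_nseq.
rewrite mulrNz; congr (perm_eq _ (_ :: _)).
by rewrite card_V -[in LHS](prednK p_gt0) mulnS natrD mul1r addKr.
Qed.

End Multipartite.
End GraphSpectra.

(** Complete graphs are the case of classes with one element. *)
Section CompleteGraph.
Variable V : finType.

Let eq_ltrans : left_transitive (@eq_op V).
Proof. by move=> x y /eqP ->. Qed.

Let eq_class (v : V) : #|eq_op v| = 1%N.
Proof. by rewrite -(card1 v); apply: eq_card => w; exact: eq_sym. Qed.

Let card_classes : #|V| = (1 * #|V|)%N.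
Proof. by rewrite mul1n. Qed.

Lemma complete_regular : regular_graph (fun v w : V => v != w) #|V|.-1.
Proof.
rewrite -[_.-1]mul1n.
exact: (multipartite_regular (@eq_refl V) eq_ltrans eq_class card_classes).
Qed.

Lemma complete_spectrum : (0 < #|V|)%N ->
  int_spectrum (fun v w : V => v != w) (#|V|.-1%:Z :: nseq #|V|.-1 (- 1)).
Proof.
move=> V0; have := multipartite_spectrum (@eq_refl V) eq_ltrans eq_class
  card_classes isT V0.
by rewrite subnn cats0 mul1n.
Qed.

End CompleteGraph.

Lemma complete_closed_walks3 (V : finType) : (0 < #|V|)%N ->
  closed_walks (adjacency (fun v w : V => v != w)) 3 =
  #|V|.-1%:R ^+ 3 - #|V|.-1%:R.
Proof.
move=> V0; rewrite -spectrum_power_sum -spectrumE.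
rewrite (perm_big _ (complete_spectrum V0)) /= big_cons map_nseq big_nseq.
by rewrite iter_addr_0 rmorphN1 -signr_odd expr1 mulNrn.
Qed.

(** * Unitary Cayley graphs and sum graphs *)

Section UnitaryCayley.
Variable R : finComUnitRingType.
Let G := unitary_cayley_graph (R := R).
Let S := unitary_cayley_sum_graph (R := R).

Lemma unitary_cayley_irreflexive : irreflexive G.
Proof. by move=> x; rewrite /G /unitary_cayley_graph subrr unitr0. Qed.

Lemma unitary_cayley_sum_regular k : regular_graph G k -> regular_graph S k.
Proof.
move=> [_ Gk]; split=> [v w|v].
  by rewrite /S /unitary_cayley_sum_graph addrC.
rewrite -(Gk (- v)); apply: eq_card => w; rewrite !unfold_in.
by rewrite /S /G /unitary_cayley_sum_graph /unitary_cayley_graph opprK addrC.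
Qed.

(** The substitution [u := - u] maps walks [v, u, w] of the sum graph to walks
    of the Cayley graph, units being stable under opposite. *)
Lemma unitary_cayley_sum_pow2 v w :
  kernel_pow (adjacency S) 2 v w = kernel_pow (adjacency G) 2 v w.
Proof.
rewrite [LHS]kernel_powS [RHS]kernel_powS (reindex_inj oppr_inj).
apply: eq_bigr => u _.
rewrite !kernel_pow1 /adjacency /S /G.
rewrite /unitary_cayley_sum_graph /unitary_cayley_graph.
by rewrite -[v - u]opprB unitrN [- u + w]addrC.
Qed.

Lemma unitary_cayley_sum_spectrum_sqr :
  perm_eq [seq z ^+ 2 | z <- spectrum S] [seq z ^+ 2 | z <- spectrum G].
Proof.
rewrite !spectrumE -(permPl (kernel_spectrum_sqr _)).
rewrite -(permPr (kernel_spectrum_sqr _)) /kernel_spectrum.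
rewrite (_ : kernel_mx _ = kernel_mx (kernel_pow (adjacency G) 2)) //.
by apply/matrixP => i j; rewrite !mxE unitary_cayley_sum_pow2.
Qed.

(** The energy is a function of the squares of the eigenvalues. *)
Lemma unitary_cayley_sum_energy : energy S = energy G.
Proof.
have energyE (e : rel R) :
    energy e = \sum_(z <- [seq z ^+ 2 | z <- spectrum e]) sqrtC `|z|.
  by rewrite big_map; apply: eq_bigr => z _; rewrite normrX sqrCK.
by rewrite !energyE (perm_big _ unitary_cayley_sum_spectrum_sqr).
Qed.

Lemma unitary_cayley_sum_integral : integral_graph G -> integral_graph S.
Proof.
move=> /allP Gint; apply/allP => z zS.
have : z ^+ 2 \in [seq z ^+ 2 | z <- spectrum G].
  rewrite -(perm_mem unitary_cayley_sum_spectrum_sqr).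
  exact: (map_f (fun z => z ^+ 2)) zS.
case/mapP => w /Gint w_int /eqP; rewrite eqf_sqr => /orP [] /eqP -> //.
by rewrite rpredN.
Qed.

(** Translation by 1 permutes [R], so it fixes the sum of all elements. *)
Lemma natr_card : #|R|%:R = 0 :> R.
Proof.
apply: (addrI (\sum_(x : R) x)); rewrite addr0.
by rewrite [RHS](reindex_inj (addIr 1)) big_split sumr_const.
Qed.

Lemma odd_card_unit2 : odd #|R| -> (2%:R : R) \is a GRing.unit.
Proof.
move=> R_odd; apply/unitrPr; exists (uphalf #|R|)%:R.
rewrite -natrM mul2n.
have -> : ((uphalf #|R|).*2 = #|R|.+1)%N.
  by rewrite uphalf_half R_odd -[in RHS](odd_double_half #|R|) R_odd doubleD.
by rewrite -natr1 natr_card add0r.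
Qed.

(** The traces differ: the Cayley graph has no loop, the sum graph has one
    at 1. *)
Lemma unit2_not_isospectral :
  (2%:R : R) \is a GRing.unit -> ~~ isospectral G S.
Proof.
move=> R2; apply/negP => /(isospectral_closed_walks 1)/eqP.
rewrite !closed_walks1 eqr_nat eq_sym; apply/negP.
rewrite [X in _ == X]eq_card0 => [|v]; last first.
  by rewrite inE unitary_cayley_irreflexive.
rewrite -lt0n; apply/card_gt0P; exists 1.
by rewrite inE.
Qed.

(** The displayed identity says that the complement has the energy of the
    Cayley graph, and the order condition that their degrees differ. *)
Lemma unitary_cayley_criterion k s :
    regular_graph G k -> int_spectrum G (k%:Z :: s) ->
    \sum_(z <- s) `|- 1 - z| + `|#|R|%:Z - 1 - k%:Z| =
      k%:Z + \sum_(z <- s) `|z| ->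
    #|R| != k.*2.+1 -> ~~ isospectral G S ->
  let graphs := [:: G; S; complement_graph G] in
  [/\ integral_graphs graphs, equienergetic graphs & non_isospectral graphs].
Proof.
move=> Gk Gs energy_eq card_ne GS graphs.
have Cs := int_spectrum_complement unitary_cayley_irreflexive Gk Gs.
have Ck := regular_complement unitary_cayley_irreflexive Gk.
have Sk := unitary_cayley_sum_regular Gk.
have C_energy : energy (complement_graph G) = energy G.
  rewrite (int_spectrum_energy Cs) (int_spectrum_energy Gs) !big_cons big_map.
  by rewrite addrC energy_eq.
have not_iso e : regular_graph e k -> ~~ isospectral e (complement_graph G).
  move=> ek; apply/negP => /(regular_isospectral ek Ck) /eqP.
  have R_gt0 : (0 < #|R|)%N by apply/card_gt0P; exists 0.
  rewrite eqn_pmul2l // => /eqP; move: card_ne R_gt0.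
  by move: #|R| => r; clear; lia.
split.
- have GI := int_spectrum_integral Gs.
  rewrite /integral_graphs /= GI (unitary_cayley_sum_integral GI).
  by rewrite (int_spectrum_integral Cs).
- by rewrite /equienergetic /= unitary_cayley_sum_energy C_energy eqxx.
- by rewrite /non_isospectral /= GS !not_iso.
Qed.

End UnitaryCayley.

(** * Local rings *)

Lemma sum_nseq (F : int -> int) n (x : int) :
  \sum_(z <- nseq n x) F z = F x * n%:Z.
Proof. by rewrite big_nseq iter_addr_0 -mulr_natr natz. Qed.

Section LocalRing.
Variables (R : finComUnitRingType) (M : {set R}).
Hypotheses (R_local : local_ring R) (M_max : maximal_ideal M).

(** A nonunit [x] generates a proper ideal; a maximal ideal above it must be
    [M] by uniqueness. *)
Lemma local_maximal_ideal x : (x \in M) = (x \isn't a GRing.unit).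
Proof.
have [[M0 M1 Mlin] _] := M_max.
apply/idP/idP => [xM|xNu].
  apply: contra M1 => xu; rewrite -(mulVr xu) -[_ * x]addr0.
  exact: Mlin.
pose idealb (I : {set R}) := [&& 0 \in I, 1 \notin I &
  [forall a, forall u in I, forall v in I, a * u + v \in I]].
have idealP (I : {set R}) : reflect (idealr_closed I) (idealb I).
  apply: (iffP and3P) => -[I0 I1 Ilin]; split=> //.
    move=> a u v uI vI; move: Ilin => /forallP /(_ a).
    by move=> /forall_inP /(_ u uI) /forall_inP /(_ v vI).
  apply/forallP => a; apply/forall_inP => u uI; apply/forall_inP => v.
  exact: Ilin.
pose xR := [set x * y | y : R].
have xR_ideal : idealb xR.
  apply/idealP; split.
  - by apply/imsetP; exists 0; rewrite ?mulr0.
  - apply: contra xNu => /imsetP [y _ xy]; apply/unitrPr; by exists y.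
  - move=> a _ _ /imsetP [y _ ->] /imsetP [z _ ->].
    by apply/imsetP; exists (a * y + z) => //; ring.
have [N /maxsetP [/idealP N_ideal N_max] xR_N] := maxset_exists xR_ideal.
have -> : M = N.
  have [L [_ L_uniq]] := R_local.
  rewrite -(L_uniq M) // (L_uniq N) //; split=> //.
  by move=> I /idealP I_ideal NI; apply: N_max.
by apply: (subsetP xR_N); apply/imsetP; exists 1; rewrite ?mulr1.
Qed.

Let E (v w : R) := w - v \in M.

Let E_refl : reflexive E.
Proof. by move=> v; rewrite /E subrr; case: M_max => -[]. Qed.

Let E_ltrans : left_transitive E.
Proof.
have [[M0 _ Mlin] _] := M_max.
move=> v w vw u; rewrite /E; apply/idP/idP => [vu|wu].
  by rewrite (_ : u - w = -1 * (w - v) + (u - v)); [exact: Mlin | ring].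
by rewrite (_ : u - v = 1 * (w - v) + (u - w)); [exact: Mlin | ring].
Qed.

Let E_class v : #|E v| = #|M|.
Proof.
rewrite -(card_imset _ (addrI v)); apply: eq_card => w; rewrite unfold_in /E.
apply/idP/imsetP => [wM|[u uM ->]].
  by exists (w - v); rewrite // addrC subrK.
by rewrite [v + u]addrC addrK.
Qed.

Let M_gt0 : (0 < #|M|)%N.
Proof. by apply/card_gt0P; exists 0; case: M_max => -[]. Qed.

Let unitaryE v w : unitary_cayley_graph v w = ~~ E v w.
Proof. by rewrite /E local_maximal_ideal negbK. Qed.

Variable p : nat.
Hypothesis card_R : #|R| = (#|M| * p)%N.

Let p_gt0 : (0 < p)%N.
Proof.
have : (0 < #|R|)%N by apply/card_gt0P; exists 0.
by rewrite card_R muln_gt0 => /andP [].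
Qed.

Lemma local_unitary_regular :
  regular_graph (unitary_cayley_graph (R := R)) (#|M| * p.-1).
Proof.
apply: (regular_iso (f := id) (e' := fun v w => ~~ E v w)) => //.
  by exists id.
exact: multipartite_regular.
Qed.

Lemma local_unitary_spectrum :
  int_spectrum (unitary_cayley_graph (R := R))
   ((#|M| * p.-1)%N%:Z :: nseq p.-1 (- #|M|%:Z) ++ nseq (#|R| - p) 0).
Proof.
apply: (int_spectrum_iso (f := id) (e' := fun v w => ~~ E v w)) => //.
  by exists id.
exact: multipartite_spectrum.
Qed.

End LocalRing.

Lemma local_case (R : finComUnitRingType) (M : {set R}) :
    local_ring R -> maximal_ideal M -> #|R| = (#|M| ^ 2)%N -> odd #|R| ->
  let graphs := [:: unitary_cayley_graph (R := R);
                    unitary_cayley_sum_graph (R := R);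
                    complement_graph (unitary_cayley_graph (R := R))] in
  [/\ integral_graphs graphs, equienergetic graphs & non_isospectral graphs].
Proof.
move=> R_local M_max card_R R_odd; rewrite expnS expn1 in card_R.
have R_gt1 : (1 < #|R|)%N.
  by apply/card_gt1P; exists 0, 1; rewrite eq_sym oner_eq0.
have m_gt1 : (1 < #|M|)%N by move: R_gt1; rewrite card_R; case: #|M| => [|[|]].
apply: unitary_cayley_criterion (local_unitary_regular R_local M_max card_R)
  (local_unitary_spectrum R_local M_max card_R) _ _
  (unit2_not_isospectral (odd_card_unit2 R_odd)).
  rewrite !big_cat /= !sum_nseq card_R; move: m_gt1.
  case: #|M| => [|[|n]] // _.
  have -> : (n.+2 * n.+2 - n.+2 = n.+2 * n.+1)%N by lia.
  have -> : `|- 1 - - n.+2%:Z| = n.+1%:Z by lia.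
  have -> : `|(n.+2 * n.+2)%N%:Z - 1 - (n.+2 * n.+2.-1)%N%:Z| = n.+1%:Z by lia.
  by rewrite subr0 normrN1 normr0 normrN /=; lia.
rewrite card_R; move: m_gt1; case: #|M| => [|[|n]] // _.
by apply/eqP; nia.
Qed.

(** * Products of two fields *)

Lemma ring_iso_unit (A B : comUnitRingType) (f : {rmorphism A -> B}) x :
  bijective f -> (f x \is a GRing.unit) = (x \is a GRing.unit).
Proof.
move=> f_bij; apply/idP/idP => [/unitrPr [b fxb]|]; last exact: rmorph_unit.
have [g _ gK] := f_bij; apply/unitrPr; exists (g b).
by apply: (bij_inj f_bij); rewrite rmorphM gK rmorph1.
Qed.

Lemma pair_unitE (A B : comUnitRingType) (p : (A * B)%type) :
  (p \is a GRing.unit) = (p.1 \is a GRing.unit) && (p.2 \is a GRing.unit).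
Proof. by []. Qed.

(** The kernel of the sum graph is the constant 1 minus the permutation
    kernel of [v |-> - v], an involution whose only fixed point is 0 when 2 is
    nonzero. *)
Lemma sum_graph_closed_walks3 (F : finFieldType) : 2%:R != 0 :> F ->
  closed_walks (adjacency (fun v w : F => v + w != 0)) 3 = #|F|.-1%:R ^+ 3.
Proof.
move=> F2; pose N (v w : F) : algC := - (v == - w)%:R.
have N_row v : \sum_w N v w = -1.
  rewrite (bigD1 (- v)) //= /N opprK eqxx big1 ?addr0 // => w wv.
  by rewrite eq_sym eqr_oppLR (negPf wv) oppr0.
have N_col w : \sum_v N v w = -1.
  rewrite (bigD1 (- w)) //= /N eqxx big1 ?addr0 // => v /negPf ->.
  by rewrite oppr0.
have N_step n v w : kernel_pow N n.+1 v w = - kernel_pow N n (- v) w.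
  rewrite kernel_powS (bigD1 (- v)) //= /N opprK eqxx mulN1r.
  rewrite big1 ?addr0 // => u uv.
  by rewrite eq_sym eqr_oppLR (negPf uv) oppr0 mul0r.
have F_gt0 : (0 < #|F|)%N by apply/card_gt0P; exists 0.
have cardF : #|F|%:R = #|F|.-1%:R + 1 :> algC by rewrite natr1 prednK.
have N3 : closed_walks N 3 = -1.
  have N3v v : kernel_pow N 3 v v = - (v == 0)%:R.
    rewrite !N_step /= !opprK [- v == v]eq_sym -addr_eq0.
    rewrite -mulr2n -[v *+ 2]mulr_natl.
    by rewrite mulf_eq0 (negPf F2).
  rewrite /closed_walks (bigD1 0) // N3v eqxx big1 => [|v /negPf v0].
    by rewrite /= addr0.
  by rewrite N3v v0 oppr0.
transitivity (closed_walks (fun v w => N v w + 1) 3).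
  rewrite -!spectrum_power_sum; congr (\sum_(z <- _) _).
  apply: kernel_spectrum_ext => v w; rewrite /adjacency /N addr_eq0.
  by case: eqP => _; rewrite ?addNr ?oppr0 ?add0r.
by rewrite (closed_walks_addc _ N_row N_col) N3 cardF; ring.
Qed.

(** When 2 vanishes the sum graph coincides with the complete graph; the
    boolean factor covers both cases. *)
Lemma field_sum_graph_closed_walks3 (F : finFieldType) :
  closed_walks (adjacency (fun v w : F => v + w != 0)) 3 =
  (#|F|.-1 ^ 3 - (2%:R == 0 :> F) * #|F|.-1)%:R.
Proof.
have [F2|F2] := eqVneq (2%:R : F) 0; last first.
  by rewrite sum_graph_closed_walks3 // mul0n subn0 natrX.
have F_gt0 : (0 < #|F|)%N by apply/card_gt0P; exists 0.
have leF : (1 * #|F|.-1 <= #|F|.-1 ^ 3)%N.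
  by rewrite mul1n; case: _.-1 => // n; rewrite -{1}[n.+1]expn1 leq_pexp2l.
rewrite natrB // natrX mul1n -complete_closed_walks3 // -!spectrum_power_sum.
congr (\sum_(z <- _) _); apply: kernel_spectrum_ext => v w.
have wN : - w = w.
  by apply/eqP; rewrite eq_sym -addr_eq0 -mulr2n -mulr_natl F2 mul0r.
by rewrite /adjacency -{1}wN subr_eq0.
Qed.

Lemma field_closed_walks3 (F : finFieldType) :
  closed_walks (adjacency (fun v w : F => v != w)) 3 =
  (#|F|.-1 ^ 3 - #|F|.-1)%:R.
Proof.
have F_gt0 : (0 < #|F|)%N by apply/card_gt0P; exists 0.
rewrite complete_closed_walks3 // natrB ?natrX //.
by case: _.-1 => // n; rewrite -{1}[n.+1]expn1 leq_pexp2l.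
Qed.

Section ProductOfTwoFields.
Variables (R : finComUnitRingType) (F1 F2 : finFieldType).
Variable f : {rmorphism R -> (F1 * F2)%type}.
Hypothesis f_bij : bijective f.
Let G := unitary_cayley_graph (R := R).
Let S := unitary_cayley_sum_graph (R := R).

Lemma field_pair_unit x :
  (x \is a GRing.unit) = ((f x).1 != 0) && ((f x).2 != 0).
Proof. by rewrite -(ring_iso_unit x f_bij) pair_unitE !unitfE. Qed.

Lemma field_pair_cayley v w :
  G v w = tensor_graph (fun x y : F1 => x != y) (fun x y : F2 => x != y)
            (f v) (f w).
Proof.
rewrite /G /unitary_cayley_graph field_pair_unit rmorphB /= !subr_eq0.
by rewrite /tensor_graph ![_ == (f v).1]eq_sym ![_ == (f v).2]eq_sym.
Qed.

Lemma field_pair_cayley_sum v w :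
  S v w = tensor_graph (fun x y : F1 => x + y != 0) (fun x y : F2 => x + y != 0)
            (f v) (f w).
Proof.
by rewrite /S /unitary_cayley_sum_graph field_pair_unit rmorphD.
Qed.

(** Closed walks of length 3 multiply along tensor products, and the sum graph
    has strictly more of them in each factor where 2 is nonzero, and as many in
    the others. *)
Lemma field_pair_not_isospectral :
    (2%:R != 0 :> F1) || (2%:R != 0 :> F2) -> (2 < #|F1|)%N -> (2 < #|F2|)%N ->
  ~~ isospectral G S.
Proof.
move=> F_2 q1 q2; apply/negP => /(isospectral_closed_walks 3).
rewrite (closed_walks_iso _ f_bij field_pair_cayley).
rewrite (closed_walks_iso _ f_bij field_pair_cayley_sum).
rewrite !closed_walks_tensor_graph !field_closed_walks3.
rewrite !field_sum_graph_closed_walks3 -!natrM => /eqP; rewrite eqr_nat.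
move: F_2 q1 q2; move: (2%:R == 0 :> F1) (2%:R == 0 :> F2) #|F1| #|F2| => b1 b2.
clear; case=> [|[|[|m]]] // [|[|[|n]]] //= b12 _ _ /eqP.
have cube k : (k.+2 ^ 3 = k.+2 + k.+1 * k.+2 * k.+3)%N.
  by rewrite !expnS expn0; ring.
rewrite !cube !addKn.
case: b1 b2 b12 => [] [] //= _; rewrite ?mul1n ?mul0n ?subn0 ?addKn; nia.
Qed.

Lemma field_pair_card : #|R| = (#|F1| * #|F2|)%N.
Proof. by rewrite (bij_eq_card f_bij) card_prod. Qed.

Lemma field_pair_case :
    (2%:R != 0 :> F1) || (2%:R != 0 :> F2) -> (2 < #|F1|)%N -> (2 < #|F2|)%N ->
    ~~ ((#|F1| == 3) && (#|F2| == 3)) ->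
  let graphs := [:: G; S; complement_graph G] in
  [/\ integral_graphs graphs, equienergetic graphs & non_isospectral graphs].
Proof.
move=> F_2 q1 q2 q33.
have F1_gt0 : (0 < #|F1|)%N := ltnW (ltnW q1).
have F2_gt0 : (0 < #|F2|)%N := ltnW (ltnW q2).
have Gk := regular_iso f_bij field_pair_cayley
  (regular_tensor (complete_regular F1) (complete_regular F2)).
have := int_spectrum_iso f_bij field_pair_cayley
  (int_spectrum_tensor (complete_spectrum F1_gt0) (complete_spectrum F2_gt0)).
rewrite /= -PoszM => Gs.
apply: unitary_cayley_criterion Gk Gs _ _
  (field_pair_not_isospectral F_2 q1 q2).
  rewrite !big_cat !big_flatten !big_map /= !sum_nseq !big_cons !big_map.
  rewrite !sum_nseq.
  rewrite field_pair_card; move: q1 q2; clear.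
  case: #|F1| #|F2| => [|[|[|m]]] // [|[|[|n]]] // _ _ /=.
  have -> : `|- 1 - m.+2%:Z * - 1| = m.+1%:Z by lia.
  have -> : `|- 1 - - 1 * n.+2%:Z| = n.+1%:Z by lia.
  have -> : `|m.+2%:Z * - 1| = m.+2%:Z by lia.
  have -> : `|- 1 * n.+2%:Z| = n.+2%:Z by lia.
  have -> : `|(m.+3 * n.+3)%N%:Z - 1 - (m.+2 * n.+2)%N%:Z| = m.+2%:Z + n.+2%:Z.
    by lia.
  have -> : `|- 1 - - 1 * - 1 : int| = 2 by [].
  have -> : `|- 1 * - 1 : int| = 1 by [].
  lia.
rewrite field_pair_card; move: q1 q2 q33; clear.
case: #|F1| #|F2| => [|[|[|m]]] // [|[|[|n]]] // _ _ mn.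
(* [r = 2 k + 1] becomes [(m + 3) (n + 3) = 2 (m + 2) (n + 2) + 1]. *)
apply/eqP => h; have /eqP : (m + n + m * n = 0)%N by lia.
by rewrite !addn_eq0 => /andP [/andP [/eqP m0 /eqP n0] _]; rewrite m0 n0 in mn.
Qed.

End ProductOfTwoFields.

Lemma prime_field_iso (p : nat) (F : finFieldType) : prime p -> #|F| = p ->
  ring_iso 'F_p F.
Proof.
move=> p_pr cardF.
have pF : p \in [pchar F] by rewrite inE p_pr -cardF natr_card eqxx.
pose h : 'F_p -> F := GRing.in_alg (pPrimeCharType pF).
have hB : zmod_morphism h.
  exact: (rmorphB (GRing.in_alg (pPrimeCharType pF))).
have hM : monoid_morphism h.
  split; first exact: (rmorph1 (GRing.in_alg (pPrimeCharType pF))).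
  exact: (rmorphM (GRing.in_alg (pPrimeCharType pF))).
pose H : {rmorphism 'F_p -> F} := HB.pack h
  (GRing.isZmodMorphism.Build _ _ h hB) (GRing.isMonoidMorphism.Build _ _ h hM).
exists H; apply: inj_card_bij; first exact: fmorph_inj.
by rewrite cardF card_Fp.
Qed.

Lemma ring_iso_trans (A B C : nzRingType) :
  ring_iso A B -> ring_iso B C -> ring_iso A C.
Proof.
case=> f f_bij [g g_bij]; exists (g \o f : {rmorphism A -> C}).
exact: bij_comp.
Qed.

Lemma ring_iso_sym (A B : nzRingType) : ring_iso A B -> ring_iso B A.
Proof.
case=> f [g fK gK].
have gB : zmod_morphism g by apply: can2_zmod_morphism fK gK.
have gM : monoid_morphism g by apply: can2_monoid_morphism fK gK.
pose g' : {rmorphism B -> A} := HB.pack g (GRing.isZmodMorphism.Build _ _ g gB)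
  (GRing.isMonoidMorphism.Build _ _ g gM).
by exists g', f.
Qed.

Lemma ring_iso_pair (A A' B B' : nzRingType) :
  ring_iso A A' -> ring_iso B B' -> ring_iso (A * B)%type (A' * B')%type.
Proof.
case=> f [f' fK f'K] [g [g' gK g'K]].
pose h (x : A * B) : A' * B' := (f x.1, g x.2).
have hB : zmod_morphism h by move=> x y; rewrite /h !rmorphB.
have hM : monoid_morphism h.
  by split=> [|x y]; rewrite /h ?rmorph1 ?rmorphM.
pose H : {rmorphism (A * B)%type -> (A' * B')%type} :=
  HB.pack h (GRing.isZmodMorphism.Build _ _ h hB)
  (GRing.isMonoidMorphism.Build _ _ h hM).
exists H, (fun y => (f' y.1, g' y.2)) => -[x y] /=.
  by rewrite /H /= /h /= fK gK.
by rewrite /H /= /h /= f'K g'K.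
Qed.

(** The excluded ring is recognized by the orders of the two factors. *)
Lemma field_pair_33 (R : finComUnitRingType) (F1 F2 : finFieldType) :
    ring_iso R (F1 * F2)%type -> #|F1| = 3 -> #|F2| = 3 ->
  ring_iso R ('F_3 * 'F_3)%type.
Proof.
move=> R_iso q1 q2; apply: ring_iso_trans R_iso (ring_iso_sym _).
by apply: ring_iso_pair; apply: prime_field_iso.
Qed.

(** * The product of fields of orders 3, 5 and 5 *)

Section F355.
Variable R : finComUnitRingType.
Variable f : {rmorphism R -> ('F_3 * 'F_5 * 'F_5)%type}.
Hypothesis f_bij : bijective f.
Let G := unitary_cayley_graph (R := R).
Let S := unitary_cayley_sum_graph (R := R).

Lemma F355_cayley v w :
  G v w = tensor_graph (tensor_graph (fun x y : 'F_3 => x != y)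
    (fun x y : 'F_5 => x != y)) (fun x y : 'F_5 => x != y) (f v) (f w).
Proof.
rewrite /G /unitary_cayley_graph -(ring_iso_unit _ f_bij) !pair_unitE !unitfE.
rewrite rmorphB /= !subr_eq0 /tensor_graph.
rewrite ![_ == (f v).1.1]eq_sym ![_ == (f v).1.2]eq_sym.
by rewrite ![_ == (f v).2]eq_sym.
Qed.

Lemma F355_case :
  let graphs := [:: G; S; complement_graph G] in
  [/\ integral_graphs graphs, equienergetic graphs & non_isospectral graphs].
Proof.
have q3 : #|'F_3| = 3 by rewrite card_Fp.
have q5 : #|'F_5| = 5 by rewrite card_Fp.
have card_R : #|R| = 75 by rewrite (bij_eq_card f_bij) !card_prod q3 q5.
have K3 := @complete_spectrum 'F_3; have K5 := @complete_spectrum 'F_5.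
rewrite q3 in K3; rewrite q5 in K5.
have k3 := complete_regular 'F_3; have k5 := complete_regular 'F_5.
rewrite q3 in k3; rewrite q5 in k5.
have Gk := regular_iso f_bij F355_cayley
  (regular_tensor (regular_tensor k3 k5) k5).
have Gs := int_spectrum_iso f_bij F355_cayley
  (int_spectrum_tensor (int_spectrum_tensor (K3 isT) (K5 isT)) (K5 isT)).
apply: unitary_cayley_criterion Gk Gs _ _ _.
  (* Both sides are sums over explicit lists of integers, equal to 256. *)
- by rewrite card_R unlock; vm_compute.
- by rewrite card_R.
- by apply: unit2_not_isospectral; rewrite odd_card_unit2 // card_R.
Qed.

End F355.

Theorem corollary4p5 (R : finComUnitRingType)
  (hR :
    (local_ring R /\
     exists M : {set R},
       [/\ maximal_ideal M, #|R| = (#|M| ^ 2)%N & odd #|R|])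
    \/
    (exists F1 F2 : finFieldType,
       [/\ ring_iso R (F1 * F2)%type,
           ~ ring_iso R ('F_3 * 'F_3)%type,
           (3 <= #|F1|)%N, (3 <= #|F2|)%N
         & odd #|F1| \/ odd #|F2|])
    \/
    ring_iso R ('F_3 * 'F_5 * 'F_5)%type) :
  let graphs := [:: unitary_cayley_graph (R := R);
                    unitary_cayley_sum_graph (R := R);
                    complement_graph (unitary_cayley_graph (R := R))] in
  [/\ integral_graphs graphs, equienergetic graphs & non_isospectral graphs].
Proof.
have odd2 (F : finFieldType) : odd #|F| -> 2%:R != 0 :> F.
  by move=> F_odd; rewrite -unitfE odd_card_unit2.
case: hR => [[R_local [M [M_max card_R R_odd]]]|[|[f f_bij]]].
- exact: local_case card_R R_odd.
- case=> F1 [F2 [R_iso R_33 q1 q2 F_odd]]; have [f f_bij] := R_iso.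
  apply: (field_pair_case f_bij) => //.
    by case: F_odd => /odd2 ->; rewrite ?orbT.
  apply/negP => /andP [/eqP c1 /eqP c2].
  exact: R_33 (field_pair_33 R_iso c1 c2).
- exact: F355_case f_bij.
Qed.
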